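(* Fix a deterministic path selection rule $\pi(s,t\mid G,H)$ and let $f(n,p)$ be its extremal function. Run the following procedure on an $n$-node directed graph $G$ with parameter $p$: set $H=(V,\emptyset)$; while there is a reachable pair $(s,t)$ in $G$ such that $\pi(s,t\mid G,H)$ has more than $f(n,p)/p$ edges not in $E(H)$, assign the path $\pi(s,t\mid G,H)$ to $(s,t)$ and add its edges to $H$; afterwards, assign to each remaining reachable pair $(s,t)$ with no assigned path the path $\pi(s,t\mid G,H)$ for the final $H$. Let $\pi(s,t)$ denote the path assigned to $(s,t)$. Then for every $n$-node directed graph $G$ and every sequence $P$ of $p$ demand pairs reachable in $G$, $$\left|\bigcup_{(s,t)\in P}E(\pi(s,t))\right|\le 2f(n,p).$$
   Context: A deterministic path selection rule takes a directed graph $G$, a subgraph $H\subseteq G$ and a pair $(s,t)$ with $t$ reachable from $s$ in $G$, and returns an $s\leadsto t$ path $\pi(s,t\mid G,H)$ in $G$. Its extremal function $f(n,p)$ is the maximum, over all $n$-node directed graphs $G$ and all sequences of $p$ reachable demand pairs, of $|E(H)|$ at the end of the process that starts with $H$ empty and, for each demand pair $(s,t)$ in turn, adds all edges of $\pi(s,t\mid G,H)$ to $H$. *)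

(* Defs.v *)
From mathcomp Require Import all_boot all_order all_algebra.

Set Implicit Arguments.
Unset Strict Implicit.
Unset Printing Implicit Defensive.

Import Order.TTheory GRing.Theory Num.Theory.

(* Nodes are labelled by 'I_n; a digraph, or a (spanning) subgraph of one, is
   given by its edge set.  A self-loop is allowed but never lies on a path. *)
Definition digraph (n : nat) := {set 'I_n * 'I_n}.

Definition edge_rel n (G : digraph n) : rel 'I_n := [rel x y | (x, y) \in G].

Definition reachable n (G : digraph n) (d : 'I_n * 'I_n) : bool :=
  connect (edge_rel G) d.1 d.2.

(* A path is the list of all its nodes, both endpoints included; the path of a
   pair (s, s) is [:: s]. *)
Definition is_path n (G : digraph n) (d : 'I_n * 'I_n) (q : seq 'I_n) : bool :=
  if q is x :: r
  then [&& x == d.1, last x r == d.2, uniq q & path (edge_rel G) x r]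
  else false.

Definition path_edges n (q : seq 'I_n) : digraph n :=
  [set e in zip q (behead q)].

(* [select G H d] is meaningful only when H is a subgraph of G and d is
   reachable in G; its value elsewhere is never used. *)
Record path_rule := PathRule {
  select :> forall n, digraph n -> digraph n -> 'I_n * 'I_n -> seq 'I_n;
  selectP : forall n (G H : digraph n) (d : 'I_n * 'I_n),
    H \subset G -> reachable G d -> is_path G d (select G H d)
}.

Definition add_path (pi : path_rule) n (G H : digraph n) (d : 'I_n * 'I_n) :
  digraph n := H :|: path_edges (pi n G H d).

Definition process (pi : path_rule) n (G : digraph n)
  (P : seq ('I_n * 'I_n)) : digraph n := foldl (add_path pi G) set0 P.

Definition extremal (pi : path_rule) (n p : nat) : nat :=
  \max_(G : digraph n)
    \max_(P : p.-tuple ('I_n * 'I_n) | all (reachable G) P) #|process pi G P|.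

Definition eligible (pi : path_rule) n (p : nat) (G H : digraph n)
  (d : 'I_n * 'I_n) : bool :=
  reachable G d &&
  ((extremal pi n p)%:R / p%:R < #|path_edges (pi n G H d) :\: H|%:R :> rat)%R.

Definition assign n (A : 'I_n * 'I_n -> option (seq 'I_n)) (d : 'I_n * 'I_n)
  (q : seq 'I_n) : 'I_n * 'I_n -> option (seq 'I_n) :=
  fun d' => if d' == d then Some q else A d'.

(* States (H, A) reachable by the while loop, A being the partial assignment.
   The choice among eligible pairs is left open at each iteration.  A pair may
   be chosen again, in which case its new path replaces the old one. *)
Inductive loop_state (pi : path_rule) n (p : nat) (G : digraph n) :
  digraph n -> ('I_n * 'I_n -> option (seq 'I_n)) -> Prop :=
| LoopInit : loop_state pi p G set0 (fun=> None)
| LoopStep H A d : loop_state pi p G H A -> eligible pi p G H d ->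
    loop_state pi p G (add_path pi G H d) (assign A d (pi n G H d)).

Definition procedure_output (pi : path_rule) n (p : nat) (G : digraph n)
  (a : 'I_n * 'I_n -> seq 'I_n) : Prop :=
  exists H A,
    [/\ loop_state pi p G H A,
        forall d, ~~ eligible pi p G H d &
        forall d, reachable G d ->
          a d = if A d is Some q then q else pi n G H d].

(* The loop cannot run forever, so [procedure_output] is always inhabited. *)
Lemma procedure_output_exists (pi : path_rule) n (p : nat) (G : digraph n) :
  exists a, procedure_output pi p G a.
Proof.
suff [H [A [runHA stopH]]] : exists H A,
    loop_state pi p G H A /\ forall d, ~~ eligible pi p G H d.
  by exists (fun d => if A d is Some q then q else pi n G H d), H, A.
have := LoopInit pi p G; move: set0 (fun=> None) => H.
have [m] := ubnP #|~: H|; elim: m H => // m IHm H ltHm A runHA.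
have [/existsP[d eld]|] := boolP [exists d, eligible pi p G H d]; last first.
  by rewrite negb_exists => /forallP stopH; exists H, A.
apply: IHm (LoopStep runHA eld).
apply: leq_trans (_ : #|~: H| <= m); last by rewrite -ltnS.
apply: proper_card; rewrite properEneq setCS subsetUl andbT.
apply/eqP => /setC_inj eqH; case/andP: eld => _.
have -> : path_edges (pi n G H d) :\: H = set0.
  by apply/eqP; rewrite setD_eq0 -{2}eqH subsetUr.
by rewrite cards0 ltNge divr_ge0 ?ler0n.
Qed.

(* Main.v *)
Require Import Defs.
From mathcomp Require Import all_boot all_order all_algebra.

(** Write [f = extremal pi n p].  Each iteration of the loop adds more than
    [f / p] edges, so [p] iterations would make the demand sequence they form
    build more than [f] edges.  The loop therefore stops in fewer than [p]
    iterations, with at most [f] edges in [H].  Every assigned path lies in [H],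
    and each of the [p] demands adds at most [f / p] edges outside of [H]. *)

(** Clearing the denominator [p] moves the threshold test from [rat] to [nat]. *)
Lemma eligibleE (pi : path_rule) (n p : nat) (G H : digraph n)
    (d : 'I_n * 'I_n) : 0 < p ->
  eligible pi p G H d =
  reachable G d && (extremal pi n p < p * #|path_edges (pi n G H d) :\: H|).
Proof.
move=> p_gt0; rewrite /eligible; congr (_ && _).
by rewrite Num.Theory.ltr_pdivrMr ?Num.Theory.ltr0n // -GRing.natrM
           Num.Theory.ltr_nat mulnC.
Qed.

Lemma process_cat_sub (pi : path_rule) (n : nat) (G : digraph n)
    (D E : seq ('I_n * 'I_n)) :
  process pi G D \subset process pi G (D ++ E).
Proof.
rewrite /process foldl_cat; elim: E (foldl _ _ D) => //= e E IHE H.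
exact: subset_trans (subsetUl _ _) (IHE _).
Qed.

Lemma card_process_le (pi : path_rule) (n p : nat) (G : digraph n)
    (D : seq ('I_n * 'I_n)) :
  size D = p -> all (reachable G) D -> #|process pi G D| <= extremal pi n p.
Proof.
move=> /eqP szD reachD; rewrite /extremal.
apply: leq_trans (leq_bigmax_cond G isT).
exact: (@leq_bigmax_cond _ (fun Q : p.-tuple _ => all (reachable G) Q)
         (fun Q : p.-tuple _ => #|process pi G Q|) (Tuple szD)).
Qed.

(** [D] lists the chosen pairs in order, so [process] replays the loop. The last conjunct is the
    invariant that bounds the length of [D]. *)
Lemma loop_state_process { pi : path_rule} {n p : nat} {G H : digraph n}
    {A : 'I_n * 'I_n -> option (seq 'I_n)} :
  0 < p -> loop_state pi p G H A ->
  exists D, [/\ H = process pi G D, all (reachable G) D, size D < p &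
                size D * (extremal pi n p).+1 <= p * #|H|].
Proof.
move=> p_gt0; elim=> [|{A}{}H A d _ [D [defH reachD ltDp leDH]] eld].
  by exists [::].
move: eld; rewrite eligibleE // => /andP[reachd gain].
have reachD' : all (reachable G) (rcons D d) by rewrite all_rcons reachd.
have leD'H : size (rcons D d) * (extremal pi n p).+1
             <= p * #|add_path pi G H d|.
  rewrite size_rcons mulSn addnC -(cardsID H) mulnDr leq_add //.
    by rewrite /add_path setUK.
  by rewrite /add_path setDUl setDv set0U.
have defH' : add_path pi G H d = process pi G (rcons D d).
  by rewrite /process foldl_rcons defH.
exists (rcons D d); split=> //.
(* Only length exactly [p] must be excluded: there the invariant, divided by [p], gives more than
   [extremal pi n p] edges from [p] demands. *)
rewrite ltn_neqAle {2}size_rcons ltDp andbT; apply/eqP => szD'.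
move: leD'H; rewrite szD' leq_pmul2l // ltnNge defH'.
by rewrite card_process_le.
Qed.

(** A path enters [H] when it is assigned, and [H] only grows. *)
Lemma assigned_path_sub { pi : path_rule} {n p : nat} {G H : digraph n}
    {A : 'I_n * 'I_n -> option (seq 'I_n)} {d : 'I_n * 'I_n} {q : seq 'I_n} :
  loop_state pi p G H A -> A d = Some q -> path_edges q \subset H.
Proof.
move=> runH; elim: runH d q => // {A}{}H A d _ IH _ d' q; rewrite /assign.
case: eqP => [_ [<-]|_ /IH subH]; first exact: subsetUr.
exact: subset_trans subH (subsetUl _ _).
Qed.

(** A union bound, kept multiplied by [p] so that [m / p] is never rounded. *)
Lemma card_bigcup_setD_le {I : Type} {T : finType} {s : seq I}
    {F : I -> {set T}} {H : {set T}} {P : pred I} {p m : nat} :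
  (forall i, P i -> p * #|F i :\: H| <= m) -> all P s ->
  p * #|(\bigcup_(i <- s) F i) :\: H| <= size s * m.
Proof.
move=> leF; elim: s => [_|i s IHs /= /andP[Pi Ps]].
  by rewrite big_nil set0D cards0 muln0.
rewrite big_cons setDUl mulSn.
apply: leq_trans (leq_add (leF i Pi) (IHs Ps)).
by rewrite -mulnDr leq_mul2l leq_card_setU orbT.
Qed.

Theorem theorem16 (pi : path_rule) (n p : nat) (hp : 0 < p) (G : digraph n)
  (a : 'I_n * 'I_n -> seq 'I_n) (ha : procedure_output pi p G a)
  (P : p.-tuple ('I_n * 'I_n)) (hP : all (reachable G) P) :
  #|\bigcup_(d <- P) path_edges (a d)| <= 2 * extremal pi n p.
Proof.
have [H [A [runH stopH defa]]] := ha.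
have [D [defH reachD ltDp _]] := loop_state_process hp runH.
have leH : #|H| <= extremal pi n p.
  (* Padding [D] with demands of [P] yields exactly [p] demands. *)
  rewrite defH; set E := take (p - size D) P.
  apply: leq_trans (subset_leq_card (process_cat_sub pi n G D E)) _.
  apply: card_process_le.
    rewrite size_cat size_takel ?size_tuple ?leq_subr //.
    by rewrite subnKC // ltnW.
  rewrite all_cat reachD; move: hP.
  by rewrite -{1}(cat_take_drop (p - size D) P) all_cat => /andP[].
have leD d : reachable G d ->
    p * #|path_edges (a d) :\: H| <= extremal pi n p.
  (* A path assigned in the loop has no edge outside [H]; any other path is chosen against the final
     [H], where its pair fails the loop test. *)
  move=> reachd; rewrite defa //; case EA: (A d) => [q|].
    have /eqP -> : path_edges q :\: H == set0.
      by rewrite setD_eq0 (assigned_path_sub runH EA).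
    by rewrite cards0 muln0.
  by have := stopH d; rewrite eligibleE // reachd -leqNgt.
have leP := card_bigcup_setD_le leD hP.
rewrite size_tuple leq_pmul2l // in leP.
(* The factor 2 comes from counting edges inside and outside [H] separately. *)
rewrite -(cardsID H) mul2n -addnn leq_add //.
exact: leq_trans (subset_leq_card (subsetIr _ _)) leH.
Qed.
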